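(* Assume the base graph is connected, so that $\mathbf M(\mathbf w)\succ 0$ for every feasible $\mathbf w$. Then $R_{\mathrm{tot}}^{\mathrm{SDP}}\le R_{\mathrm{tot}}^{\mathrm{MI}}$, and every optimal solution $(\mathbf R^\star,\mathbf w^\star,\mathbf z^\star)$ of $(\mathcal P1)$ satisfies $\mathbf R^\star=\mathbf M(\mathbf w^\star)^{-1}$. Thus the optimal value of $(\mathcal P1)$ lower-bounds the mixed-integer optimum $R_{\mathrm{tot}}^{\mathrm{MI}}$, and its difference from the objective of any feasible discrete design upper-bounds that design's suboptimality: for every feasible pair $(\widehat{\mathbf w},\widehat{\mathbf z})$ of $(\mathcal P0)$, $$R_{\mathrm{tot}}(\widehat{\mathbf w})-R_{\mathrm{tot}}^{\mathrm{MI}}\le R_{\mathrm{tot}}(\widehat{\mathbf w})-R_{\mathrm{tot}}^{\mathrm{SDP}}.$$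
   Context: Let $\mathcal G$ be an undirected graph on $n$ nodes $v_1,\dots,v_n$ with base edge set $\mathcal E_{\mathrm b}$ (no self-loops) and fixed positive base edge weights; let $\mathbf L_{\mathrm b}\in\mathbb S^n_+$ be its weighted Laplacian (degree matrix minus weighted adjacency matrix). Let $\mathcal E_{\mathrm c}$ be a set of $p$ candidate edges, i.e. unordered pairs of distinct nodes, disjoint from $\mathcal E_{\mathrm b}$, indexed by $1,\dots,p$. For a candidate $e=\{v_i,v_j\}$ fix an arbitrary orientation and let $\mathbf a_e\in\mathbb R^n$ have $i$-th entry $1$, $j$-th entry $-1$, and zeros elsewhere. For $\mathbf w\in\mathbb R^p_{\ge 0}$ put $$\mathbf M(\mathbf w)=\mathbf L_{\mathrm b}+\sum_{e\in\mathcal E_{\mathrm c}}w_e\mathbf a_e\mathbf a_e^\top+\tfrac1n\mathbf 1\mathbf 1^\top,\qquad R_{\mathrm{tot}}(\mathbf w)=n\operatorname{Tr}\bigl(\mathbf M(\mathbf w)^{-1}\bigr)-n .$$ Data: per-unit costs $\mathbf c\in\mathbb R^p$ with $c_e>0$, budget $C>0$, target cardinality $k\in\{1,\dots,p\}$, weight bounds $0<w_{\min}\le w_{\max}$. Problem $(\mathcal P0)$: minimize $R_{\mathrm{tot}}(\mathbf w)$ over $\mathbf w\in\mathbb R^p_{\ge0}$, $\mathbf z\in\{0,1\}^p$ subject to $\mathbf c^\top\mathbf w\le C$; $z_iw_{\min}\le w_i\le z_iw_{\max}$ for $i=1,\dots,p$; $\mathbf 1^\top\mathbf z=k$. Its optimal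 value is $R_{\mathrm{tot}}^{\mathrm{MI}}$. A feasible discrete design is a feasible pair of $(\mathcal P0)$. Problem $(\mathcal P1)$: minimize $n\operatorname{Tr}(\mathbf R)-n$ over $\mathbf R\in\mathbb S^n_+$, $\mathbf w\in\mathbb R^p_{\ge 0}$, $\mathbf z\in\mathbb R^p$ subject to $\mathbf c^\top\mathbf w\le C$; $z_iw_{\min}\le w_i\le z_iw_{\max}$ and $0\le z_i\le1$ for $i=1,\dots,p$; $\mathbf 1^\top\mathbf z=k$; and $$\begin{pmatrix}\mathbf M(\mathbf w)&\mathbf I\\ \mathbf I&\mathbf R\end{pmatrix}\succeq0 .$$ Its optimal value is $R_{\mathrm{tot}}^{\mathrm{SDP}}$. Here $\mathbb S^n_+$ is the set of real symmetric positive semidefinite $n\times n$ matrices, $\succeq,\succ$ are the positive (semi)definite orders, and optimal values are infima over the feasible set. *)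

(* Defs.v *)
From mathcomp Require Import all_boot all_order all_algebra.
From mathcomp Require Import boolp classical_sets reals constructive_ereal ereal.

Set Implicit Arguments.
Unset Strict Implicit.
Unset Printing Implicit Defensive.

Import Order.TTheory GRing.Theory Num.Theory.
Local Open Scope ring_scope.

Definition upair (T : finType) (x y : T) : {set T} := [set x; y]%SET.

(* Undirected edges are two-element sets of nodes. The i-th candidate edge is
   the unordered pair {src i, tgt i}; the ordered pair (src i, tgt i) is its
   arbitrary orientation, and [cand_inj] says that the candidates are distinct
   as unordered pairs. [base_weight] is only meaningful on base edges. *)
Record design_data (R : realType) (n p : nat) := DesignData {
  base_edges : {set {set 'I_n}};
  base_weight : {set 'I_n} -> R;
  src : 'I_p -> 'I_n;
  tgt : 'I_p -> 'I_n;
  cost : 'cV[R]_p;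
  budget : R;
  card_target : nat;
  wmin : R;
  wmax : R;
  base_edges_card2 : forall e, e \in base_edges -> #|e| = 2%N;
  base_weight_gt0 : forall e, e \in base_edges -> 0 < base_weight e;
  cand_neq : forall i, src i != tgt i;
  cand_inj : injective (fun i => upair (src i) (tgt i));
  cand_disjoint : forall i, upair (src i) (tgt i) \notin base_edges;
  cost_gt0 : forall i, 0 < cost i 0;
  budget_gt0 : 0 < budget;
  card_target_bounds : (1 <= card_target <= p)%N;
  wmin_gt0 : 0 < wmin;
  wmin_le_wmax : wmin <= wmax
}.

Definition base_connected (R : realType) (n p : nat) (D : design_data R n p) :
    Prop :=
  forall u v : 'I_n, connect (fun i j => upair i j \in base_edges D) u v.

Definition psdmx (R : realType) (m : nat) (A : 'M[R]_m) : Prop :=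
  A^T = A /\ forall x : 'cV[R]_m, 0 <= (x^T *m A *m x) 0 0.

Definition pdmx (R : realType) (m : nat) (A : 'M[R]_m) : Prop :=
  A^T = A /\ forall x : 'cV[R]_m, x != 0 -> 0 < (x^T *m A *m x) 0 0.

(* The diagonal vanishes because upair i i is a singleton, hence not an edge. *)
Definition base_adjacency (R : realType) (n p : nat) (D : design_data R n p) :
    'M[R]_n :=
  \matrix_(i, j) (if upair i j \in base_edges D
                  then base_weight D (upair i j) else 0).

Definition base_degree (R : realType) (n p : nat) (D : design_data R n p) :
    'M[R]_n :=
  diag_mx (\row_i \sum_j base_adjacency D i j).

Definition base_laplacian (R : realType) (n p : nat) (D : design_data R n p) :
    'M[R]_n :=
  base_degree D - base_adjacency D.

Definition incidence (R : realType) (n p : nat) (D : design_data R n p)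
    (e : 'I_p) : 'cV[R]_n :=
  \col_k (if k == src D e then 1 else if k == tgt D e then -1 else 0).

Definition ones (R : realType) (n : nat) : 'cV[R]_n := const_mx 1.

Definition Mmx (R : realType) (n p : nat) (D : design_data R n p)
    (w : 'cV[R]_p) : 'M[R]_n :=
  base_laplacian D
  + \sum_e w e 0 *: (incidence D e *m (incidence D e)^T)
  + n%:R^-1 *: (ones R n *m (ones R n)^T).

Definition Rtot (R : realType) (n p : nat) (D : design_data R n p)
    (w : 'cV[R]_p) : R :=
  n%:R * \tr (invmx (Mmx D w)) - n%:R.

Definition P0_feasible (R : realType) (n p : nat) (D : design_data R n p)
    (w z : 'cV[R]_p) : Prop :=
  [/\ forall i, 0 <= w i 0,
      forall i, z i 0 = 0 \/ z i 0 = 1,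
      \sum_i cost D i 0 * w i 0 <= budget D,
      forall i, z i 0 * wmin D <= w i 0 <= z i 0 * wmax D
    & \sum_i z i 0 = (card_target D)%:R].

Definition P1_feasible (R : realType) (n p : nat) (D : design_data R n p)
    (Rm : 'M[R]_n) (w z : 'cV[R]_p) : Prop :=
  [/\ psdmx Rm /\ (forall i, 0 <= w i 0),
      \sum_i cost D i 0 * w i 0 <= budget D,
      forall i, (z i 0 * wmin D <= w i 0 <= z i 0 * wmax D)
                /\ (0 <= z i 0 <= 1),
      \sum_i z i 0 = (card_target D)%:R
    & psdmx (block_mx (Mmx D w) 1%:M 1%:M Rm)].

Definition P1_objective (R : realType) (n : nat) (Rm : 'M[R]_n) : R :=
  n%:R * \tr Rm - n%:R.

Definition P1_optimal (R : realType) (n p : nat) (D : design_data R n p)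
    (Rm : 'M[R]_n) (w z : 'cV[R]_p) : Prop :=
  P1_feasible D Rm w z /\
  forall (Rm' : 'M[R]_n) (w' z' : 'cV[R]_p),
    P1_feasible D Rm' w' z' -> P1_objective Rm <= P1_objective Rm'.

(* Optimal values are infima in the extended reals: +oo when infeasible. *)
Definition R_MI (R : realType) (n p : nat) (D : design_data R n p) : \bar R :=
  ereal_inf [set x | exists w z : 'cV[R]_p,
    P0_feasible D w z /\ x = (Rtot D w)%:E]%classic.

Definition R_SDP (R : realType) (n p : nat) (D : design_data R n p) : \bar R :=
  ereal_inf [set x | exists (Rm : 'M[R]_n) (w z : 'cV[R]_p),
    P1_feasible D Rm w z /\ x = (P1_objective Rm)%:E]%classic.

(* Main.v *)
Require Import Defs.
From mathcomp Require Import all_boot all_order all_algebra.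
From mathcomp Require Import boolp classical_sets reals constructive_ereal ereal.
From mathcomp Require Import ring lra.

(** Completing the square, for [M] positive definite the block matrix
    [[M, 1], [1, R]] is positive semidefinite iff [R - M^-1] is. Hence [M^-1]
    is the feasible [R] of least trace for given [w, z], and it is the only one
    of that trace, since a positive semidefinite matrix of trace zero vanishes.
    Every feasible discrete design [(w, z)] therefore lifts to the feasible
    point [(M(w)^-1, w, z)] of the relaxation, with the same objective value.
    Positive definiteness of [M(w)] comes from its quadratic form, a sum of
    squares: if it vanishes at [x], then [x] is constant along base edges, hence
    constant by connectedness, and has sum zero. *)

Set Implicit Arguments.
Unset Strict Implicit.
Unset Printing Implicit Defensive.

Import Order.TTheory GRing.Theory Num.Theory.
Local Open Scope ring_scope.

Lemma quad_formE (R : realType) (m : nat) (A : 'M[R]_m) (x : 'cV[R]_m) :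
  (x^T *m A *m x) 0 0 = \sum_i \sum_j A i j * x i 0 * x j 0.
Proof.
rewrite mxE exchange_big; apply: eq_bigr => j _.
rewrite mxE mulr_suml; apply: eq_bigr => i _.
by rewrite mxE [x i 0 * _]mulrC.
Qed.

Lemma quad_form_rank1 (R : realType) (m : nat) (a x : 'cV[R]_m) :
  (x^T *m (a *m a^T) *m x) 0 0 = (\sum_i a i 0 * x i 0) ^+ 2.
Proof.
rewrite quad_formE expr2 mulr_suml; apply: eq_bigr => i _.
rewrite mulr_sumr; apply: eq_bigr => j _.
by rewrite mxE big_ord1 mxE; ring.
Qed.

(** Expanding the square on the right gives the degree term once for each index. The two copies
    agree by symmetry of [A], hence the factor 1/2. *)
Lemma quad_form_laplacian (R : realType) (m : nat) (A : 'M[R]_m)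
    (x : 'cV[R]_m) : A^T = A ->
  (x^T *m (diag_mx (\row_i \sum_j A i j) - A) *m x) 0 0 =
  2^-1 * \sum_i \sum_j A i j * (x i 0 - x j 0) ^+ 2.
Proof.
move=> symA; rewrite mulmxBr mulmxBl [LHS]mxE [in X in _ + X]mxE !quad_formE.
set d := \sum_i _; set q := \sum_i _.
have -> : d = \sum_i \sum_j A i j * x i 0 ^+ 2.
  apply: eq_bigr => i _; rewrite (bigD1 i) //= big1 ?addr0 => [|j neji].
    by rewrite !mxE eqxx mulr1n -mulr_suml expr2 mulrA.
  by rewrite !mxE eq_sym (negPf neji) mulr0n !mul0r.
set s := \sum_i _.
have sE : s = \sum_i \sum_j A i j * x j 0 ^+ 2.
  rewrite /s exchange_big; apply: eq_bigr => i _; apply: eq_bigr => j _.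
  by rewrite -[in LHS]symA mxE.
suff -> : \sum_i \sum_j A i j * (x i 0 - x j 0) ^+ 2 = s + s - 2 * q by field.
rewrite {2}sE /s /q mulr_sumr -big_split -sumrB; apply: eq_bigr => i _ /=.
rewrite mulr_sumr -big_split -sumrB; apply: eq_bigr => j _ /=; ring.
Qed.

(** The form is tested at [e_i + t e_j]. Taking [t = 0] makes the diagonal nonnegative, so a zero
    trace kills it; then [t = 1] and [t = -1] bound [S i j] from both sides by zero. *)
Lemma psdmx_trace (R : realType) (m : nat) (S : 'M[R]_m) :
  psdmx S -> 0 <= \tr S /\ (\tr S = 0 -> S = 0).
Proof.
move=> [symS S_ge0].
have quadD i j t : 0 <= S i i + t * S i j *+ 2 + t ^+ 2 * S j j.
  have := S_ge0 (delta_mx i 0 + t *: delta_mx j 0).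
  have dE a b : (delta_mx 0 a *m S *m delta_mx b 0 : 'M[R]_1) 0 0 = S a b.
    by rewrite -rowE -colE !mxE.
  have addE (A B : 'M[R]_1) : (A + B) 0 0 = A 0 0 + B 0 0 by rewrite mxE.
  have scaleE c (A : 'M[R]_1) : (c *: A) 0 0 = c * A 0 0 by rewrite mxE.
  have -> : (delta_mx i 0 + t *: delta_mx j 0 : 'cV[R]_m)^T =
      delta_mx 0 i + t *: delta_mx 0 j.
    by rewrite linearD linearZ /= !trmx_delta.
  rewrite !mulmxDl !mulmxDr.
  rewrite -!scalemxAl -!scalemxAr !addE !scaleE !dE.
  have -> : S j i = S i j by rewrite -[in LHS]symS mxE.
  by congr (0 <= _); ring.
have diag_ge0 i : 0 <= S i i.
  by have := quadD i i 0; rewrite expr2 !mul0r mul0rn !addr0.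
split=> [|tr0]; first exact: sumr_ge0.
have diag0 i : S i i = 0.
  move/eqP: tr0; rewrite psumr_eq0 // => /allP/(_ i).
  by rewrite mem_index_enum => /(_ isT)/eqP.
apply/matrixP => i j; rewrite [RHS]mxE.
have := quadD i j 1; have := quadD i j (-1).
rewrite !diag0 !mulr0 !addr0 !add0r => h1 h2; lra.
Qed.

Lemma pdmx_unit (R : realType) (m : nat) (M : 'M[R]_m) :
  pdmx M -> M \in unitmx.
Proof.
move=> [_ M_gt0]; rewrite -unitmx_tr -row_free_unit -kermx_eq0.
apply/rowV0P => v /sub_kermxP vM0; apply/eqP/negPn/negP => v0.
have := M_gt0 v^T; rewrite trmx_eq0 => /(_ v0).
by rewrite -mulmxA -[M *m _]trmxK trmx_mul trmxK vM0 trmx0 mulmx0 mxE ltxx.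
Qed.

Lemma psdmx_schur (R : realType) (m : nat) (M Rm : 'M[R]_m) : pdmx M ->
  psdmx (block_mx M 1%:M 1%:M Rm) <-> psdmx (Rm - invmx M).
Proof.
move=> pdM; have Mu := pdmx_unit pdM; have [symM M_gt0] := pdM.
have symMV : (invmx M)^T = invmx M by rewrite trmx_inv symM.
have M_ge0 (x : 'cV_m) : 0 <= (x^T *m M *m x) 0 0.
  have [->|x0] := eqVneq x 0; first by rewrite mulmx0 mxE.
  exact: ltW (M_gt0 _ x0).
have squareE (x y : 'cV_m) : (col_mx x y)^T *m block_mx M 1%:M 1%:M Rm *m col_mx x y =
    (x + invmx M *m y)^T *m M *m (x + invmx M *m y) +
    y^T *m (Rm - invmx M) *m y :> 'M[R]_1.
  rewrite tr_col_mx mul_row_block mul_row_col !mulmx1.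
  have -> : (x + invmx M *m y)^T = x^T + y^T *m invmx M.
    by rewrite linearD /= trmx_mul symMV.
  rewrite !(mulmxDl, mulmxDr, mulmxBr, mulmxBl) mulmxKV // !mulmxA.
  rewrite mulmxK // !addrA.
  set a := x^T *m M *m x; set b := y^T *m x; set c := x^T *m y.
  set e := y^T *m invmx M *m y; set f := y^T *m Rm *m y.
  by rewrite mulmxN mulNmx -/e (addrAC _ e) addrK.
split=> -[symB B_ge0]; split.
- move: symB; rewrite tr_block_mx => /eq_block_mx[_ _ _ symRm].
  by rewrite linearB /= symRm symMV.
(* This first block makes the completed square vanish, leaving the form of the Schur complement at
   [y]. *)
- move=> y; have := B_ge0 (col_mx (- (invmx M *m y)) y).
  by rewrite squareE addNr mulmx0 add0r.
- move: symB; rewrite linearB /= symMV => /addIr symRm.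
  by rewrite tr_block_mx symM symRm trmx1.
- move=> v; rewrite -[v]vsubmxK squareE mxE addr_ge0 //.
Qed.

Lemma psdmx_inv (R : realType) (m : nat) (M : 'M[R]_m) : pdmx M ->
  psdmx (invmx M) /\ psdmx (block_mx M 1%:M 1%:M (invmx M)).
Proof.
move=> pdM; have Mu := pdmx_unit pdM; have [symM M_gt0] := pdM.
have symMV : (invmx M)^T = invmx M by rewrite trmx_inv symM.
split; last first.
  (* For the choice [invmx M], the Schur complement is zero. *)
  apply/(psdmx_schur _ pdM); rewrite subrr.
  by split=> [|x]; rewrite ?trmx0 // mulmx0 mul0mx mxE.
split=> // x; have [->|x0] := eqVneq x 0; first by rewrite mulmx0 mxE.
(* The form of [invmx M] at [x] equals the form of [M] at [invmx M *m x]. *)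
have y0 : invmx M *m x != 0.
  by apply: contra x0 => /eqP yx0; rewrite -[x](mulKVmx Mu) yx0 mulmx0.
by have /ltW := M_gt0 _ y0; rewrite trmx_mul symMV mulmxKV // mulmxA.
Qed.

Lemma upairC (T : finType) (x y : T) : upair x y = upair y x.
Proof. exact: finset.setUC. Qed.

Section Design.
Context (R : realType) (n p : nat) (D : design_data R n p).

Lemma base_adjacency_sym : (base_adjacency D)^T = base_adjacency D.
Proof. by apply/matrixP => i j; rewrite !mxE upairC. Qed.

Lemma base_adjacency_ge0 i j : 0 <= base_adjacency D i j.
Proof. by rewrite mxE; case: ifP => // /base_weight_gt0/ltW. Qed.

Lemma Mmx_sym (w : 'cV[R]_p) : (Mmx D w)^T = Mmx D w.
Proof.
rewrite /Mmx /base_laplacian /base_degree !linearD /= linearN /= linear_sum /=.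
rewrite tr_diag_mx base_adjacency_sym linearZ /= trmx_mul trmxK.
congr (_ + _ + _); apply: eq_bigr => e _.
by rewrite linearZ /= trmx_mul trmxK.
Qed.

Lemma quad_form_Mmx (w : 'cV[R]_p) (x : 'cV[R]_n) :
  (x^T *m Mmx D w *m x) 0 0 =
  2^-1 * (\sum_i \sum_j base_adjacency D i j * (x i 0 - x j 0) ^+ 2)
  + \sum_e w e 0 * (\sum_i incidence D e i 0 * x i 0) ^+ 2
  + n%:R^-1 * (\sum_i x i 0) ^+ 2.
Proof.
rewrite -(quad_form_laplacian x base_adjacency_sym) -/(base_degree D).
rewrite -/(base_laplacian D) /Mmx; move: (base_laplacian D) => L.
rewrite !mulmxDr !mulmxDl [LHS]mxE [in X in X + _]mxE.
congr (_ + _ + _).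
  rewrite mulmx_sumr mulmx_suml summxE; apply: eq_bigr => e _.
  by rewrite -scalemxAr -scalemxAl mxE quad_form_rank1.
rewrite -scalemxAr -scalemxAl mxE quad_form_rank1; congr (_ * _ ^+ 2).
by apply: eq_bigr => i _; rewrite mxE mul1r.
Qed.

Lemma Mmx_pd (w : 'cV[R]_p) :
  base_connected D -> (forall i, 0 <= w i 0) -> pdmx (Mmx D w).
Proof.
move=> conn w_ge0; split; first exact: Mmx_sym.
move=> x x0; rewrite quad_form_Mmx.
set a := \sum_i _; set b := \sum_e _; set c := _ ^+ 2.
have ain_ge0 i : 0 <= \sum_j base_adjacency D i j * (x i 0 - x j 0) ^+ 2.
  by apply: sumr_ge0 => j _; rewrite mulr_ge0 ?sqr_ge0 ?base_adjacency_ge0.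
have a_ge0 : 0 <= a by apply: sumr_ge0.
have b_ge0 : 0 <= b by apply: sumr_ge0 => e _; rewrite mulr_ge0 ?sqr_ge0.
have c_ge0 : 0 <= n%:R^-1 * c by rewrite mulr_ge0 ?sqr_ge0 ?invr_ge0 ?ler0n.
have a2_ge0 : 0 <= 2^-1 * a by rewrite mulr_ge0 // invr_ge0 ler0n.
rewrite lt0r (addr_ge0 (addr_ge0 a2_ge0 b_ge0) c_ge0) andbT.
apply: contra x0; rewrite paddr_eq0 ?addr_ge0 // paddr_eq0 //.
case/andP=> /andP[+ _]; rewrite !mulf_eq0 !invr_eq0 !pnatr_eq0 /= => a0 c0.
(* By [a0] every term of the Laplacian sum vanishes, and on a base edge its weight is positive. *)
have edge_const i j : upair i j \in base_edges D -> x i 0 = x j 0.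
  move=> ije; move: a0; rewrite psumr_eq0 // => /allP/(_ i).
  rewrite mem_index_enum => /(_ isT); rewrite psumr_eq0; last first.
    by move=> k _; rewrite mulr_ge0 ?sqr_ge0 ?base_adjacency_ge0.
  move=> /allP/(_ j); rewrite mem_index_enum => /(_ isT).
  rewrite mxE ije mulf_eq0 gt_eqF ?base_weight_gt0 //= sqrf_eq0 subr_eq0.
  by move/eqP.
have const i j : x i 0 = x j 0.
  have /connectP[s + ->] := conn i j.
  elim: s i => //= k s IHs i /andP[/edge_const -> ks]; exact: IHs.
apply/eqP/matrixP => i j; rewrite ord1 [RHS]mxE.
have n_gt0 : (0 < n)%N := leq_ltn_trans (leq0n i) (ltn_ord i).
(* [c0] still allows [n = 0], where the inverse is 0 by convention; the index [i] excludes this. So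
   the entries of [x], all equal, have sum zero. *)
move: c0; rewrite eqn0Ngt n_gt0 orbb /=.
rewrite (eq_bigr (fun=> x i 0)) => [|k _]; last exact: const.
by rewrite sumr_const card_ord mulrn_eq0 eqn0Ngt n_gt0 => /eqP.
Qed.

Lemma P0_feasible_P1 (w z : 'cV[R]_p) :
  base_connected D -> P0_feasible D w z ->
  P1_feasible D (invmx (Mmx D w)) w z.
Proof.
move=> conn [w_ge0 z01 costw wz sumz].
have [V_psd B_psd] := psdmx_inv (Mmx_pd conn w_ge0).
split=> // i; split; first exact: wz.
by case: (z01 i) => ->; rewrite lexx ler01.
Qed.

Lemma P1_feasible_inv (Rm : 'M[R]_n) (w z : 'cV[R]_p) :
  base_connected D -> P1_feasible D Rm w z ->
  P1_feasible D (invmx (Mmx D w)) w z.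
Proof.
move=> conn [[_ w_ge0] costw wz sumz _].
by have [V_psd B_psd] := psdmx_inv (Mmx_pd conn w_ge0).
Qed.

(** A target of at least 1 forces a candidate edge, hence a node. This allows the factor [n] in the
    objective to be cancelled. *)
Lemma nodes_gt0 : (0 < n)%N.
Proof.
have /andP[k_gt0 le_kp] := card_target_bounds D.
exact: leq_ltn_trans (ltn_ord (src D (Ordinal (leq_trans k_gt0 le_kp)))).
Qed.

Lemma P1_optimal_inv (Rm : 'M[R]_n) (w z : 'cV[R]_p) :
  base_connected D -> P1_optimal D Rm w z -> Rm = invmx (Mmx D w).
Proof.
move=> conn [feas opt]; have [[_ w_ge0] _ _ _] := feas.
move=> /(psdmx_schur _ (Mmx_pd conn w_ge0))/psdmx_trace.
rewrite linearB /= => -[tr_ge0 tr_eq0]; apply/eqP; rewrite -subr_eq0.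
apply/eqP/tr_eq0/le_anti; rewrite tr_ge0 andbT subr_le0.
(* Optimality against the inverse at the same [w] and [z] gives the trace inequality opposite to
   [tr_ge0]. *)
have := opt _ _ _ (P1_feasible_inv conn feas).
by rewrite lerD2r ler_pM2l // ltr0n nodes_gt0.
Qed.

(** The set of values of the discrete problem is contained in that of the relaxation; this also
    covers an infeasible discrete problem, with infimum [+oo]. *)
Lemma R_SDP_le_R_MI : base_connected D -> (R_SDP D <= R_MI D)%E.
Proof.
move=> conn; apply: le_ereal_inf => _ [w [z [feas ->]]].
by exists (invmx (Mmx D w)), w, z; split; first exact: P0_feasible_P1.
Qed.

End Design.

Theorem proposition1 (R : realType) (n p : nat) (D : design_data R n p)
    (Hconn : base_connected D) :
  (forall w z : 'cV[R]_p, P0_feasible D w z -> pdmx (Mmx D w))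
  /\ (forall (Rm : 'M[R]_n) (w z : 'cV[R]_p),
        P1_feasible D Rm w z -> pdmx (Mmx D w))
  /\ (R_SDP D <= R_MI D)%E
  /\ (forall (Rm : 'M[R]_n) (w z : 'cV[R]_p),
        P1_optimal D Rm w z -> Rm = invmx (Mmx D w))
  /\ (forall w z : 'cV[R]_p, P0_feasible D w z ->
        ((Rtot D w)%:E - R_MI D <= (Rtot D w)%:E - R_SDP D)%E).
Proof.
split=> [w z [w_ge0 _ _ _ _]|]; first exact: Mmx_pd.
split=> [Rm w z [[_ w_ge0] _ _ _ _]|]; first exact: Mmx_pd.
have SDP_le_MI := R_SDP_le_R_MI Hconn.
split=> //; split=> [Rm w z|w z _]; first exact: P1_optimal_inv.
(* Negation reverses the order and adding a fixed real preserves it, also at infinite values. *)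
by rewrite leeD2l // leeN2.
Qed.
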